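(* Let $U:\mathcal{X}\to\mathsf{Pos}$ be a concretely order-regular category. The locally monotone functor $(-)_\ast:\mathcal{X}\to\mathsf{Rel}(\mathcal{X})^{\mathrm{co}}$ has the following properties: (1) every $f_\ast$ has a right adjoint in $\mathsf{Rel}(\mathcal{X})$; (2) $q_\ast\cdot p^\ast=g^\ast\cdot f_\ast$ for every exact square in $\mathcal{X}$ consisting of $p:W\to X_1$, $q:W\to X_2$, $f:X_1\to Z$, $g:X_2\to Z$; (3) $e_\ast\cdot e^\ast=\mathrm{Id}$ for every surjection $e$ in $\mathcal{X}$. Moreover, $(-)_\ast$ is universal with respect to these properties: for any concretely order-regular category $\mathcal{K}$, the assignment $H\mapsto H\circ(-)_\ast$ gives a bijection between locally monotone functors $H:\mathsf{Rel}(\mathcal{X})^{\mathrm{co}}\to\mathcal{K}^{\mathrm{co}}$ and locally monotone functors $F:\mathcal{X}\to\mathcal{K}^{\mathrm{co}}$ with the properties: (1') every $Ff$ has a right adjoint $(Ff)^r$ in $\mathcal{K}$; (2') $Fq\cdot(Fp)^r=(Fg)^r\cdot Ff$ for all exact squares as in (2); (3') $Fe\cdot (Fe)^r=\mathrm{Id}$ for all epis $e$.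
   Context: $\mathsf{Pos}$ is the category of posets and monotone maps; a $\mathsf{Pos}$-category is a category enriched in posets (ordered homsets, monotone composition); a locally monotone functor preserves the order on homsets; $\mathcal{C}^{\mathrm{co}}$ reverses the order of homsets. A concretely order-regular category is a locally monotone functor $U:\mathcal{C}\to\mathsf{Pos}$ such that: $U$ is order-preserving and order-reflecting on homsets; $\mathcal{C}$ has, and $U$ preserves, finite limits in the $\mathsf{Pos}$-enriched (weighted) sense (in particular comma objects); $\mathcal{C}$ has a factorisation system $(\mathcal{E},\mathcal{M})$ with $U\mathcal{E}$ = surjections and $U\mathcal{M}$ = order-embeddings, such that every (surjection, embedding)-factorisation of $Uf$ lifts uniquely to one in $\mathcal{C}$. A surjection/embedding in $\mathcal{C}$ is an arrow whose $U$-image is one. A weakening relation $R:A\looparrowright B$ of posets is a monotone map $A^{\mathrm{op}}\times B\to\mathbbm{2}$, i.e. a subset with $a'\le aRb\le b'\Rightarrow a'Rb'$; relations compose relationally ($S\cdot R$ means $R$ then $S$), identity is the order. For $f:A\to B$, $f_\ast=\{(a,b)\mid f(a)\le b\}:A\looparrowright B$ and $f^\ast=\{(b,a)\mid b\le f(a)\}:B\looparrowright A$. A $\mathcal{C}$-relation $A\looparrowright B$ is a weakening relation $UA\looparrowright UB$ whose graph (with its projections) is the $U$-image of a span in $\mathcal{C}$ (equivalently an isomorphism class of weakening-closed embedding spans). $\mathsf{Rel}(\mathcal{C})$ has the objects of $\mathcal{C}$, $\mathcal{C}$-relations as arrows, composition/identities as in posets, inclusion as order; $f_\ast$ and $f^\ast$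 are $\mathcal{C}$-relations for $f$ in $\mathcal{C}$, giving functors $(-)_\ast:\mathcal{C}\to\mathsf{Rel}(\mathcal{C})^{\mathrm{co}}$ and $(-)^\ast:\mathcal{C}^{\mathrm{op}}\to\mathsf{Rel}(\mathcal{C})$. A square $p:W\to X_1,q:W\to X_2,f:X_1\to Z,g:X_2\to Z$ in $\mathcal{C}$ is exact if $f\circ p\le g\circ q$ and for all $x\in UX_1,y\in UX_2$ with $Uf(x)\le Ug(y)$ there is $w\in UW$ with $x\le Up(w)$ and $Uq(w)\le y$.
   Formalization: In (3') ''for all epis e'' is replaced by ''for all surjections e'', as in (3); with categorical epis the claim fails, e.g. for the epi inclusion of the 3-chain into 2×2 in bounded distributive lattices, K = Pos and H = Rel(X)(2×2,−). *)

(* Defs.v *)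
From Stdlib Require Export Relations FinFun.
From Stdlib Require Import List Bool.
From Stdlib Require Import ProofIrrelevance FunctionalExtensionality PropExtensionality.

Set Implicit Arguments.
Unset Strict Implicit.
Unset Printing Implicit Defensive.

Record poset := Poset {
  carrier :> Type;
  le : relation carrier;
  le_order : order carrier le
}.
Arguments le {p} _ _.
Notation "x ⊑ y" := (le x y) (at level 70, no associativity).

Lemma le_refl (P : poset) (x : P) : x ⊑ x.
Proof. apply (ord_refl _ _ (le_order P)). Qed.

Lemma le_trans (P : poset) (x y z : P) : x ⊑ y -> y ⊑ z -> x ⊑ z.
Proof. apply (ord_trans _ _ (le_order P)). Qed.

Lemma le_antisym (P : poset) (x y : P) : x ⊑ y -> y ⊑ x -> x = y.
Proof. apply (ord_antisym _ _ (le_order P)). Qed.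

Record monotone (P Q : poset) := Monotone {
  mfun :> P -> Q;
  mfun_mono : forall x y, x ⊑ y -> mfun x ⊑ mfun y
}.

Lemma monotone_eq (P Q : poset) (f g : monotone P Q) :
  (forall x, f x = g x) -> f = g.
Proof.
  destruct f as [f hf], g as [g hg]; simpl; intros e.
  assert (f = g) by now apply functional_extensionality.
  subst g; f_equal; apply proof_irrelevance.
Qed.

Lemma monotone_order (P Q : poset) :
  order (monotone P Q) (fun f g => forall x, f x ⊑ g x).
Proof.
  split.
  - intros f x; apply le_refl.
  - intros f g h fg gh x; exact (le_trans (fg x) (gh x)).
  - intros f g fg gf; apply monotone_eq; intros x; now apply le_antisym.
Qed.

Definition monotone_poset (P Q : poset) : poset := Poset (monotone_order P Q).

Definition order_embedding (P Q : poset) (f : monotone P Q) : Prop :=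
  forall x y, f x ⊑ f y <-> x ⊑ y.

Definition order_iso (P Q : poset) (f : monotone P Q) : Prop :=
  order_embedding f /\ Surjective f.

Lemma dual_order (P : poset) : order P (fun x y => y ⊑ x).
Proof.
  split.
  - intros x; apply le_refl.
  - intros x y z xy yz; exact (le_trans yz xy).
  - intros x y xy yx; now apply le_antisym.
Qed.

Definition dual (P : poset) : poset := Poset (dual_order P).

Record poscat := PosCat {
  ob :> Type;
  hom : ob -> ob -> poset;
  idm : forall A, hom A A;
  comp : forall A B C, hom B C -> hom A B -> hom A C;
  comp_mono : forall A B C (g g' : hom B C) (f f' : hom A B),
    g ⊑ g' -> f ⊑ f' -> comp g f ⊑ comp g' f';
  comp_idl : forall A B (f : hom A B), comp (idm B) f = f;
  comp_idr : forall A B (f : hom A B), comp f (idm A) = f;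
  comp_assoc : forall A B C D (h : hom C D) (g : hom B C) (f : hom A B),
    comp h (comp g f) = comp (comp h g) f
}.
Arguments hom {p} _ _.
Arguments idm {p} A.
Arguments comp {p A B C} _ _.
Notation "g ∘ f" := (comp g f) (at level 40, left associativity).

Definition Pos : poscat.
Proof.
  refine (@PosCat poset monotone_poset
    (fun A => @Monotone A A (fun x => x) (fun x y h => h))
    (fun A B C g f => @Monotone A C (fun x => mfun g (mfun f x))
       (fun x y h => mfun_mono g (mfun_mono f h)))
    _ _ _ _).
  - intros A B C g g' f f' hg hf x; simpl in *.
    exact (le_trans (hg _) (mfun_mono g' (hf x))).
  - intros A B f; now apply monotone_eq.
  - intros A B f; now apply monotone_eq.
  - intros A B C D h g f; now apply monotone_eq.
Defined.

Definition co (C : poscat) : poscat :=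
  @PosCat C (fun A B => dual (hom A B)) (@idm C) (@comp C)
    (fun A B D g g' f f' hg hf => @comp_mono C A B D g' g f' f hg hf)
    (@comp_idl C) (@comp_idr C) (@comp_assoc C).

Record lmfunctor (C D : poscat) := LMFunctor {
  fob :> C -> D;
  fmap : forall A B : C, hom A B -> hom (fob A) (fob B);
  fmap_mono : forall (A B : C) (f g : hom A B), f ⊑ g -> fmap f ⊑ fmap g;
  fmap_id : forall A : C, fmap (idm A) = idm (fob A);
  fmap_comp : forall (A B E : C) (g : hom B E) (f : hom A B),
    fmap (g ∘ f) = fmap g ∘ fmap f
}.
Arguments fmap {C D} l {A B} _.

Definition fcomp (C D E : poscat) (G : lmfunctor D E) (F : lmfunctor C D) :
  lmfunctor C E.
Proof.
  refine (@LMFunctor C E (fun A => G (F A)) (fun A B f => fmap G (fmap F f))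
            _ _ _).
  - intros A B f g h; now do 2 apply fmap_mono.
  - intros A; now rewrite !fmap_id.
  - intros A B B' g f; now rewrite !fmap_comp.
Defined.

Definition hom_functor (C : poscat) (A : C) : lmfunctor C Pos.
Proof.
  refine (@LMFunctor C Pos (fun B => @hom C A B)
    (fun B B' g => @Monotone (hom A B) (hom A B') (fun f => g ∘ f)
       (fun f f' h => comp_mono (le_refl g) h))
    _ _ _).
  - intros B B' g g' h f; exact (comp_mono h (le_refl f)).
  - intros B; apply monotone_eq; intros f; apply comp_idl.
  - intros B B' B'' g g'; apply monotone_eq; intros f; simpl.
    symmetry; apply comp_assoc.
Defined.

Record nattrans (C D : poscat) (F G : lmfunctor C D) := NatTrans {
  ntapp :> forall A : C, hom (F A) (G A);
  ntnat : forall (A B : C) (f : hom A B),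
    ntapp B ∘ fmap F f = fmap G f ∘ ntapp A
}.

Definition right_adjoint (C : poscat) (A B : C) (f : hom A B) (r : hom B A) :
    Prop :=
  idm A ⊑ r ∘ f /\ f ∘ r ⊑ idm B.

Definition has_right_adjoint (C : poscat) (A B : C) (f : hom A B) : Prop :=
  exists r : hom B A, right_adjoint f r.

Definition is_iso (C : poscat) (A B : C) (f : hom A B) : Prop :=
  exists g : hom B A, g ∘ f = idm A /\ f ∘ g = idm B.

Section WeightedLimits.
Variables (J C : poscat) (W : lmfunctor J Pos) (D : lmfunctor J C).

Definition wcone (L : C) := nattrans W (fcomp (hom_functor L) D).

Definition wleg (L : C) (c : wcone L) (j : J) (w : (W j : poset)) : hom L (D j) :=
  mfun (ntapp c j) w.

Definition wcone_le (L : C) (c c' : wcone L) : Prop :=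
  forall j : J, ntapp c j ⊑ ntapp c' j.

Definition wcone_precomp (L A : C) (c : wcone L) (h : hom A L) : wcone A.
Proof.
  refine (@NatTrans J Pos W (fcomp (hom_functor A) D)
    (fun j => @Monotone (W j) (hom A (D j)) (fun w => wleg c w ∘ h)
       (fun w w' e => comp_mono (mfun_mono (ntapp c j) e) (le_refl h))) _).
  intros j k u; apply monotone_eq; intros w; simpl.
  rewrite comp_assoc; f_equal.
  exact (f_equal (fun m : monotone _ _ => mfun m w) (ntnat c u)).
Defined.

(** [h |-> c ∘ h] is an isomorphism of posets from [C(A,L)] onto
    [[J,Pos](W, C(A,D-))], for every [A]. *)
Definition is_wlimit (L : C) (c : wcone L) : Prop :=
  forall A : C,
    (forall h h' : hom A L,
       wcone_le (wcone_precomp c h) (wcone_precomp c h') <-> h ⊑ h') /\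
    (forall d : wcone A, exists h : hom A L, wcone_precomp c h = d).

(** Finite posets are the finitely presentable objects of [Pos]. *)
Definition finite_weight : Prop :=
  Finite J /\ (forall j k : J, Finite (hom j k)) /\
  (forall j : J, Finite (W j : poset)).

End WeightedLimits.

Definition wcone_map (J C E : poscat) (W : lmfunctor J Pos) (D : lmfunctor J C)
    (G : lmfunctor C E) (L : C) (c : wcone W D L) : wcone W (fcomp G D) (G L).
Proof.
  refine (@NatTrans J Pos W (fcomp (hom_functor (G L)) (fcomp G D))
    (fun j => @Monotone (W j) (hom (G L) (G (D j))) (fun w => fmap G (wleg c w))
       (fun w w' e => fmap_mono G (mfun_mono (ntapp c j) e))) _).
  intros j k u; apply monotone_eq; intros w; simpl.
  rewrite <- fmap_comp; f_equal.
  exact (f_equal (fun m : monotone _ _ => mfun m w) (ntnat c u)).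
Defined.

Definition has_finite_wlimits (C : poscat) : Prop :=
  forall (J : poscat) (W : lmfunctor J Pos) (D : lmfunctor J C),
    finite_weight W -> exists (L : C) (c : wcone W D L), is_wlimit c.

Definition preserves_finite_wlimits (C E : poscat) (G : lmfunctor C E) : Prop :=
  forall (J : poscat) (W : lmfunctor J Pos) (D : lmfunctor J C),
    finite_weight W ->
    forall (L : C) (c : wcone W D L), is_wlimit c -> is_wlimit (wcone_map G c).

Definition arrow_class (C : poscat) := forall A B : C, hom A B -> Prop.

Record factorisation (C : poscat) (E M : arrow_class C) (A B : C) (f : hom A B) :=
  Factorisation {
    fmid : C;
    fleft : hom A fmid;
    fright : hom fmid B;
    fleft_in : E _ _ fleft;
    fright_in : M _ _ fright;
    fact_eq : fright ∘ fleft = f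
  }.
Arguments factorisation {C} E M {A B} f.

Record factorisation_system (C : poscat) (E M : arrow_class C) : Prop := {
  fs_iso_left : forall (A B : C) (f : hom A B), is_iso f -> E _ _ f;
  fs_iso_right : forall (A B : C) (f : hom A B), is_iso f -> M _ _ f;
  fs_comp_left : forall (A B D : C) (g : hom B D) (f : hom A B),
    E _ _ g -> E _ _ f -> E _ _ (g ∘ f);
  fs_comp_right : forall (A B D : C) (g : hom B D) (f : hom A B),
    M _ _ g -> M _ _ f -> M _ _ (g ∘ f);
  fs_factor : forall (A B : C) (f : hom A B), inhabited (factorisation E M f);
  fs_diagonal : forall (A B A' B' : C) (e : hom A B) (m : hom A' B')
      (u : hom A A') (v : hom B B'),
    E _ _ e -> M _ _ m -> m ∘ u = v ∘ e ->
    exists! d : hom B A', d ∘ e = u /\ m ∘ d = v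
}.

Definition pos_surjection : arrow_class Pos := fun A B f => Surjective (mfun f).
Definition pos_embedding : arrow_class Pos := fun A B f => order_embedding f.

Section Concrete.
Variables (C : poscat) (U : lmfunctor C Pos).

Definition surjection_over : arrow_class C := fun A B f => pos_surjection (fmap U f).
Definition embedding_over : arrow_class C := fun A B f => pos_embedding (fmap U f).

Definition factorisation_image (A B : C) (f : hom A B)
    (x : factorisation surjection_over embedding_over f) :
    factorisation pos_surjection pos_embedding (fmap U f) :=
  @Factorisation Pos pos_surjection pos_embedding (U A) (U B) (fmap U f)
    (U (fmid x)) (fmap U (fleft x)) (fmap U (fright x))
    (fleft_in x) (fright_in x)
    (eq_trans (eq_sym (fmap_comp U (fright x) (fleft x)))
              (f_equal (fmap U) (fact_eq x))).

End Concrete.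

(** The left and right classes of the factorisation system are the arrows whose
    image under [forget] is surjective, respectively an order-embedding; in
    [or_lift], factorisations are lifted on the nose (up to isomorphism, that
    clause would already follow from [or_fs]). *)
Record order_regular := OrderRegular {
  or_cat :> poscat;
  forget : lmfunctor or_cat Pos;
  or_reflect : forall (A B : or_cat) (f g : hom A B),
    fmap forget f ⊑ fmap forget g -> f ⊑ g;
  or_limits : has_finite_wlimits or_cat;
  or_preserve : preserves_finite_wlimits forget;
  or_fs : factorisation_system (surjection_over forget) (embedding_over forget);
  or_lift : forall (A B : or_cat) (f : hom A B)
      (y : factorisation pos_surjection pos_embedding (fmap forget f)),
    exists! x : factorisation (surjection_over forget) (embedding_over forget) f,
      factorisation_image x = y
}.

Definition und (X : order_regular) (A : X) : poset := forget X A.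
Definition umap (X : order_regular) (A B : X) (f : hom A B) :
  monotone (und A) (und B) := fmap (forget X) f.

Definition surjection (X : order_regular) (A B : X) (f : hom A B) : Prop :=
  surjection_over (forget X) f.

Definition exact_square (X : order_regular) (W X1 X2 Z : X)
    (p : hom W X1) (q : hom W X2) (f : hom X1 Z) (g : hom X2 Z) : Prop :=
  f ∘ p ⊑ g ∘ q /\
  forall (x : und X1) (y : und X2), umap f x ⊑ umap g y ->
    exists w : und W, x ⊑ umap p w /\ umap q w ⊑ y.

Record weakening (A B : poset) := Weakening {
  wrel :> A -> B -> Prop;
  wrel_closed : forall a a' b b', a' ⊑ a -> wrel a b -> b ⊑ b' -> wrel a' b'
}.

Lemma weakening_eq (A B : poset) (R S : weakening A B) :
  (forall a b, R a b <-> S a b) -> R = S.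
Proof.
  destruct R as [R hR], S as [S hS]; simpl; intros e.
  assert (R = S).
  { apply functional_extensionality; intros a.
    apply functional_extensionality; intros b.
    apply propositional_extensionality, e. }
  subst S; f_equal; apply proof_irrelevance.
Qed.

Definition graph_type (A B : poset) (R : weakening A B) : Type :=
  {x : A * B | R (fst x) (snd x)}.

Lemma graph_order (A B : poset) (R : weakening A B) :
  order (graph_type R) (fun x y => fst (proj1_sig x) ⊑ fst (proj1_sig y) /\
                                   snd (proj1_sig x) ⊑ snd (proj1_sig y)).
Proof.
  split.
  - intros x; split; apply le_refl.
  - intros x y z [h1 h2] [h3 h4]; split; eapply le_trans; eauto.
  - intros [[a b] h] [[a' b'] h'] [h1 h2] [h3 h4]; simpl in *.
    assert (a = a') by now apply le_antisym.
    assert (b = b') by now apply le_antisym.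
    subst; f_equal; apply proof_irrelevance.
Qed.

Definition graph (A B : poset) (R : weakening A B) : poset := Poset (graph_order R).

Definition graph_fst (A B : poset) (R : weakening A B) : monotone (graph R) A :=
  @Monotone (graph R) A (fun x => fst (proj1_sig x)) (fun x y h => proj1 h).

Definition graph_snd (A B : poset) (R : weakening A B) : monotone (graph R) B :=
  @Monotone (graph R) B (fun x => snd (proj1_sig x)) (fun x y h => proj2 h).

(** The graph of [R], with its projections, is (isomorphic to) the image of a
    span. *)
Definition is_crel (X : order_regular) (A B : X) (R : weakening (und A) (und B)) :
    Prop :=
  exists (W : X) (p : hom W A) (q : hom W B) (i : monotone (und W) (graph R)),
    order_iso i /\
    (forall w, graph_fst R (i w) = umap p w) /\
    (forall w, graph_snd R (i w) = umap q w).

Record crel (X : order_regular) (A B : X) := CRel {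
  crel_rel :> weakening (und A) (und B);
  crel_tab : is_crel crel_rel
}.

Lemma crel_eq (X : order_regular) (A B : X) (R S : crel A B) :
  (forall a b, R a b <-> S a b) -> R = S.
Proof.
  destruct R as [R hR], S as [S hS]; simpl; intros e.
  apply weakening_eq in e; subst S; f_equal; apply proof_irrelevance.
Qed.

Lemma is_crelP (X : order_regular) (A B : X) (R : weakening (und A) (und B)) :
  is_crel R <->
  exists (W : X) (p : hom W A) (q : hom W B),
    (forall w w' : und W, umap p w ⊑ umap p w' -> umap q w ⊑ umap q w' -> w ⊑ w') /\
    (forall a b, R a b <-> exists w : und W, umap p w = a /\ umap q w = b).
Proof.
  split.
  - intros (W & p & q & i & [hi si] & e1 & e2).
    exists W, p, q; split.
    + intros w w' h1 h2; apply hi; split.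
      * change (graph_fst R (i w) ⊑ graph_fst R (i w')); now rewrite !e1.
      * change (graph_snd R (i w) ⊑ graph_snd R (i w')); now rewrite !e2.
    + intros a b; split.
      * intros r; destruct (si (exist _ (a, b) r)) as [w hw].
        exists w; rewrite <- e1, <- e2, hw; now split.
      * intros [w [<- <-]]; rewrite <- e1, <- e2; exact (proj2_sig (i w)).
  - intros (W & p & q & hpq & hR).
    exists W, p, q.
    assert (r : forall w, R (umap p w) (umap q w)).
    { intros w; apply hR; now exists w. }
    pose (i := @Monotone (und W) (graph R)
      (fun w => exist (fun x => R (fst x) (snd x)) (umap p w, umap q w) (r w))
      (fun w w' h => conj (mfun_mono (umap p) h) (mfun_mono (umap q) h))).
    exists i; repeat split.
    + intros [h1 h2]; now apply hpq.
    + now apply mfun_mono.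
    + now apply mfun_mono.
    + intros [[a b] ab]; pose proof ab as ab'; apply hR in ab'.
      destruct ab' as [w [e1 e2]]; simpl in *; subst a b.
      exists w; unfold i; simpl; f_equal; apply proof_irrelevance.
Qed.

Section Thin.
Variables (T : Type) (r : T -> T -> Prop).
Hypotheses (r_refl : forall a, r a a) (r_trans : forall a b c, r b c -> r a b -> r a c).

Lemma thin_order (a b : T) : order (r a b) (fun _ _ => True).
Proof. split; repeat intro; trivial; apply proof_irrelevance. Qed.

Definition thin : poscat.
Proof.
  refine (@PosCat T (fun a b => Poset (thin_order a b)) r_refl r_trans _ _ _ _);
    intros; simpl; trivial; apply proof_irrelevance.
Defined.
End Thin.

(** The comma object of a cospan is its limit weighted by
    [one --false--> two <--true-- one]. *)
Inductive cospan_ob := cs_left | cs_right | cs_apex.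

Definition cospan_le (a b : cospan_ob) : Prop :=
  match a, b with
  | cs_left, cs_left | cs_right, cs_right | _, cs_apex => True
  | _, _ => False
  end.

Definition cospan : poscat.
Proof.
  apply (@thin cospan_ob cospan_le).
  - intros []; exact I.
  - intros [] [] []; simpl; tauto.
Defined.

Definition pair_cat : poscat.
Proof.
  apply (@thin bool (fun a b => Is_true (eqb a b))).
  - intros []; exact I.
  - intros [] [] []; simpl; tauto.
Defined.

Lemma unit_order : order unit (fun _ _ => True).
Proof. split; repeat intro; trivial. now destruct x, y. Qed.
Definition one : poset := Poset unit_order.

Lemma bool_order : order bool Bool.le.
Proof.
  split.
  - intros []; simpl; trivial.
  - intros [] [] []; simpl; trivial; discriminate.
  - intros [] []; simpl; trivial; discriminate.
Qed.
Definition two : poset := Poset bool_order.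

Definition const_map (P Q : poset) (y : Q) : monotone P Q :=
  @Monotone P Q (fun _ => y) (fun _ _ _ => le_refl y).

Lemma finite_Prop_True : Finite True.
Proof. exists (I :: nil); intros []; now left. Qed.
Lemma finite_Prop_False : Finite False.
Proof. exists nil; intros []. Qed.

Definition comma_weight : lmfunctor cospan Pos.
Proof.
  refine (@LMFunctor cospan Pos
    (fun a : cospan_ob => match a with cs_apex => two | _ => one end)
    (fun a b : cospan_ob =>
       match a, b return cospan_le a b ->
         monotone (match a with cs_apex => two | _ => one end)
                  (match b with cs_apex => two | _ => one end) with
       | cs_left, cs_left => fun _ => const_map one (tt : one)
       | cs_right, cs_right => fun _ => const_map one (tt : one)
       | cs_left, cs_apex => fun _ => const_map one (false : two)
       | cs_right, cs_apex => fun _ => const_map one (true : two)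
       | cs_apex, cs_apex => fun _ => @Monotone two two (fun x => x) (fun _ _ h => h)
       | _, _ => fun h => match h with end
       end) _ _ _).
  - intros [] [] f g h; try destruct f; intros []; simpl; trivial.
  - intros []; apply monotone_eq; intros []; reflexivity.
  - intros [] [] [] g f; try destruct f; try destruct g;
      apply monotone_eq; intros []; reflexivity.
Defined.

Lemma comma_weight_finite : finite_weight comma_weight.
Proof.
  split; [|split].
  - exists (cs_left :: cs_right :: cs_apex :: nil); intros []; simpl; tauto.
  - intros [] []; simpl; auto using finite_Prop_True, finite_Prop_False.
  - intros []; simpl.
    + exists (tt :: nil); intros []; now left.
    + exists (tt :: nil); intros []; now left.
    + exists (true :: false :: nil); intros []; simpl; tauto.
Qed.

Definition cospan_diagram (C : poscat) (A B Z : C) (f : hom A Z) (g : hom B Z) :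
  lmfunctor cospan C.
Proof.
  refine (@LMFunctor cospan C
    (fun a : cospan_ob =>
       match a with cs_left => A | cs_right => B | cs_apex => Z end)
    (fun a b : cospan_ob =>
       match a, b return cospan_le a b ->
         hom (match a with cs_left => A | cs_right => B | cs_apex => Z end)
             (match b with cs_left => A | cs_right => B | cs_apex => Z end) with
       | cs_left, cs_left => fun _ => idm A
       | cs_right, cs_right => fun _ => idm B
       | cs_left, cs_apex => fun _ => f
       | cs_right, cs_apex => fun _ => g
       | cs_apex, cs_apex => fun _ => idm Z
       | _, _ => fun h => match h with end
       end) _ _ _).
  - intros [] [] u v h; try destruct u; apply le_refl.
  - intros []; reflexivity.
  - intros [] [] [] v u; try destruct u; try destruct v;
      simpl; now rewrite ?comp_idl, ?comp_idr.
Defined.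

Definition comma_cone (C : poscat) (A B Z V : C) (f : hom A Z) (g : hom B Z)
    (p : hom V A) (q : hom V B) (h : f ∘ p ⊑ g ∘ q) :
  wcone comma_weight (cospan_diagram f g) V.
Proof.
  refine (@NatTrans cospan Pos comma_weight
    (fcomp (hom_functor V) (cospan_diagram f g))
    (fun a : cospan_ob =>
       match a return monotone (comma_weight a) (hom V (cospan_diagram f g a)) with
       | cs_left => const_map one (p : hom V A)
       | cs_right => const_map one (q : hom V B)
       | cs_apex => @Monotone two (hom V Z)
           (fun b : bool => if b then g ∘ q else f ∘ p)
           (fun b b' e => _)
       end) _).
  - intros [] [] u; try destruct u; apply monotone_eq; intros []; simpl;
      now rewrite ?comp_idl.
  Unshelve.
  destruct b, b'; simpl in *; try discriminate; auto using le_refl.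
Defined.

Definition pair_weight : lmfunctor pair_cat Pos.
Proof.
  refine (@LMFunctor pair_cat Pos (fun _ => one)
            (fun _ _ _ => const_map one (tt : one)) _ _ _).
  - intros; intro; exact I.
  - intros; apply monotone_eq; intros []; reflexivity.
  - intros; apply monotone_eq; intros []; reflexivity.
Defined.

Lemma pair_weight_finite : finite_weight pair_weight.
Proof.
  split; [|split].
  - exists (true :: false :: nil); intros []; simpl; tauto.
  - intros [] []; simpl; auto using finite_Prop_True, finite_Prop_False.
  - intros b; exists (tt :: nil); intros []; now left.
Qed.

Definition pair_diagram (C : poscat) (A B : C) : lmfunctor pair_cat C.
Proof.
  refine (@LMFunctor pair_cat C (fun a : bool => if a then A else B)
    (fun a b : bool =>
       match a, b return Is_true (eqb a b) ->
         hom (if a then A else B) (if b then A else B) with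
       | true, true => fun _ => idm A
       | false, false => fun _ => idm B
       | _, _ => fun h => match h with end
       end) _ _ _).
  - intros [] [] u v h; try destruct u; apply le_refl.
  - intros []; reflexivity.
  - intros [] [] [] v u; try destruct u; try destruct v;
      simpl; now rewrite ?comp_idl.
Defined.

Definition pair_cone (C : poscat) (A B V : C) (p : hom V A) (q : hom V B) :
  wcone pair_weight (pair_diagram A B) V.
Proof.
  refine (@NatTrans pair_cat Pos pair_weight
    (fcomp (hom_functor V) (pair_diagram A B))
    (fun a : bool =>
       match a return monotone one (hom V (pair_diagram A B a)) with
       | true => const_map one (p : hom V A)
       | false => const_map one (q : hom V B)
       end) _).
  intros [] [] u; try destruct u; apply monotone_eq; intros []; simpl;
    now rewrite ?comp_idl.
Defined.

Lemma wleg_eq (J C : poscat) (W : lmfunctor J Pos) (D : lmfunctor J C) (L : C)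
    (c d : wcone W D L) : c = d -> forall j w, wleg c (j := j) w = wleg d w.
Proof. now intros ->. Qed.

Lemma wleg_nat (J C : poscat) (W : lmfunctor J Pos) (D : lmfunctor J C) (L : C)
    (c : wcone W D L) (j k : J) (u : hom j k) (w : (W j : poset)) :
  wleg c (mfun (fmap W u) w) = fmap D u ∘ wleg c w.
Proof. exact (f_equal (fun m : monotone _ _ => mfun m w) (ntnat c u)). Qed.

Section Tabulation.
Variable X : order_regular.

Lemma umap_id (A : X) (x : und A) : umap (idm A) x = x.
Proof. unfold umap; now rewrite fmap_id. Qed.

Lemma umap_comp (A B D : X) (g : hom B D) (f : hom A B) (x : und A) :
  umap (g ∘ f) x = umap g (umap f x).
Proof. unfold umap; now rewrite fmap_comp. Qed.

Lemma comma_exists (A B Z : X) (f : hom A Z) (g : hom B Z) :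
  exists (L : X) (p : hom L A) (q : hom L B),
    (forall w w' : und L, umap p w ⊑ umap p w' -> umap q w ⊑ umap q w' -> w ⊑ w') /\
    (forall w : und L, umap f (umap p w) ⊑ umap g (umap q w)) /\
    (forall a b, umap f a ⊑ umap g b ->
       exists w : und L, umap p w = a /\ umap q w = b).
Proof.
  destruct (@or_limits X cospan comma_weight (cospan_diagram f g)
              comma_weight_finite) as (L & c & hc).
  pose proof (@or_preserve X cospan comma_weight (cospan_diagram f g)
                comma_weight_finite L c hc one) as [emb onto].
  exists L, (@wleg _ _ _ _ _ c cs_left (tt : one)),
    (@wleg _ _ _ _ _ c cs_right (tt : one)).
  pose proof (@wleg_nat _ _ _ _ _ c cs_left cs_apex I (tt : one)) as e1.
  pose proof (@wleg_nat _ _ _ _ _ c cs_right cs_apex I (tt : one)) as e2.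
  simpl in e1, e2.
  assert (le12 : (@wleg _ _ _ _ _ c cs_apex (false : two)) ⊑
                 (@wleg _ _ _ _ _ c cs_apex (true : two))).
  { apply (mfun_mono (ntapp c cs_apex)); reflexivity. }
  rewrite e1, e2 in le12.
  apply (fmap_mono (forget X)) in le12.
  assert (sq : forall w : und L,
    umap f (umap (@wleg _ _ _ _ _ c cs_left (tt : one)) w) ⊑
    umap g (umap (@wleg _ _ _ _ _ c cs_right (tt : one)) w)).
  { intros w; rewrite <- !umap_comp; exact (le12 w). }
  split; [|split]; [|exact sq|].
  - intros w w' h1 h2.
    specialize (emb (const_map one w) (const_map one w')).
    refine (proj1 emb _ tt).
    intros [] [] []; simpl; try exact h1; try exact h2.
    + change (umap (@wleg _ _ _ _ _ c cs_apex (true : two)) w ⊑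
              umap (@wleg _ _ _ _ _ c cs_apex (true : two)) w').
      rewrite e2, !umap_comp; now apply mfun_mono.
    + change (umap (@wleg _ _ _ _ _ c cs_apex (false : two)) w ⊑
              umap (@wleg _ _ _ _ _ c cs_apex (false : two)) w').
      rewrite e1, !umap_comp; now apply mfun_mono.
  - intros a b ab.
    pose (d0 := @comma_cone Pos (und A) (und B) (und Z) one (umap f) (umap g)
      (const_map one a) (const_map one b) (fun _ => ab)).
    pose (d := @NatTrans cospan Pos comma_weight
      (fcomp (hom_functor (one : Pos)) (fcomp (forget X) (cospan_diagram f g)))
      (fun j : cospan_ob =>
         match j return monotone (comma_weight j)
           (@hom Pos one (forget X (cospan_diagram f g j))) with
         | cs_left => ntapp d0 cs_left
         | cs_right => ntapp d0 cs_right
         | cs_apex => ntapp d0 cs_apex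
         end)).
    destruct (onto (d ltac:(
      intros [] [] []; apply monotone_eq; intros []; apply monotone_eq; intros [];
      simpl; rewrite ?fmap_id; reflexivity))) as [h eh].
    exists (h tt); split.
    + exact (f_equal (fun m : monotone one _ => mfun m tt)
               (@wleg_eq _ _ _ _ _ _ _ eh cs_left (tt : one))).
    + exact (f_equal (fun m : monotone one _ => mfun m tt)
               (@wleg_eq _ _ _ _ _ _ _ eh cs_right (tt : one))).
Qed.

Lemma product_exists (A B : X) :
  exists (L : X) (p : hom L A) (q : hom L B),
    (forall w w' : und L, umap p w ⊑ umap p w' -> umap q w ⊑ umap q w' -> w ⊑ w') /\
    (forall (V : X) (f : hom V A) (g : hom V B),
       exists h : hom V L, p ∘ h = f /\ q ∘ h = g).
Proof.
  destruct (@or_limits X pair_cat pair_weight (pair_diagram A B)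
              pair_weight_finite) as (L & c & hc).
  pose proof (@or_preserve X pair_cat pair_weight (pair_diagram A B)
                pair_weight_finite L c hc one) as [emb _].
  exists L, (@wleg _ _ _ _ _ c true (tt : one)), (@wleg _ _ _ _ _ c false (tt : one)).
  split.
  - intros w w' h1 h2.
    specialize (emb (const_map one w) (const_map one w')).
    refine (proj1 emb _ tt).
    intros [] [] []; simpl; assumption.
  - intros V f g; destruct (proj2 (hc V) (pair_cone f g)) as [h eh].
    exists h; split.
    + exact (@wleg_eq _ _ _ _ _ _ _ eh true (tt : one)).
    + exact (@wleg_eq _ _ _ _ _ _ _ eh false (tt : one)).
Qed.

Definition id_weakening (A : poset) : weakening A A :=
  @Weakening A A (fun a b => a ⊑ b)
    (fun a a' b b' h1 h2 h3 => le_trans h1 (le_trans h2 h3)).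

Definition comp_weakening (A B C : poset) (S : weakening B C) (R : weakening A B) :
  weakening A C.
Proof.
  refine (@Weakening A C (fun a c => exists b, R a b /\ S b c) _).
  intros a a' c c' ha [b [r s]] hc; exists b; split.
  - exact (wrel_closed ha r (le_refl b)).
  - exact (wrel_closed (le_refl b) s hc).
Defined.

Definition lower_weakening (A B : poset) (f : monotone A B) : weakening A B :=
  @Weakening A B (fun a b => f a ⊑ b)
    (fun a a' b b' h1 h2 h3 => le_trans (mfun_mono f h1) (le_trans h2 h3)).

Definition upper_weakening (A B : poset) (f : monotone A B) : weakening B A :=
  @Weakening B A (fun b a => b ⊑ f a)
    (fun b b' a a' h1 h2 h3 => le_trans h1 (le_trans h2 (mfun_mono f h3))).

Lemma comma_is_crel (A B Z : X) (f : hom A Z) (g : hom B Z)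
    (R : weakening (und A) (und B)) :
  (forall a b, R a b <-> umap f a ⊑ umap g b) -> is_crel R.
Proof.
  intros hR; apply is_crelP.
  destruct (comma_exists f g) as (L & p & q & emb & sq & onto).
  exists L, p, q; split; [exact emb|].
  intros a b; rewrite hR; split; [apply onto|].
  intros [w [<- <-]]; apply sq.
Qed.

Lemma id_is_crel (A : X) : is_crel (id_weakening (und A)).
Proof. apply (@comma_is_crel A A A (idm A) (idm A)); intros; now rewrite !umap_id. Qed.

Lemma lower_is_crel (A B : X) (f : hom A B) : is_crel (lower_weakening (umap f)).
Proof. apply (@comma_is_crel A B B f (idm B)); intros; now rewrite umap_id. Qed.

Lemma upper_is_crel (A B : X) (f : hom A B) : is_crel (upper_weakening (umap f)).
Proof. apply (@comma_is_crel B A B (idm B) f); intros; now rewrite umap_id. Qed.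

Lemma comp_is_crel (A B C : X) (S : weakening (und B) (und C))
    (R : weakening (und A) (und B)) :
  is_crel S -> is_crel R -> is_crel (comp_weakening S R).
Proof.
  rewrite !is_crelP.
  intros (V & s & t & _ & hS) (W & p & q & _ & hR).
  destruct (comma_exists q s) as (L & l & r & _ & sq & onto).
  destruct (product_exists A C) as (P & pA & pC & embP & pairing).
  destruct (pairing L (p ∘ l) (t ∘ r)) as (h & eA & eC).
  destruct (fs_factor (or_fs X) h) as [[T e m he hm em]].
  exists T, (pA ∘ m), (pC ∘ m).
  assert (kA : forall w, umap (pA ∘ m) (umap e w) = umap p (umap l w)).
  { intros w; rewrite <- !umap_comp, <- comp_assoc, em; now rewrite eA. }
  assert (kC : forall w, umap (pC ∘ m) (umap e w) = umap t (umap r w)).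
  { intros w; rewrite <- !umap_comp, <- comp_assoc, em; now rewrite eC. }
  split.
  - intros w w' h1 h2; rewrite !umap_comp in h1, h2.
    apply hm; now apply embP.
  - intros a c; split.
    + intros [b [hab hbc]].
      apply hR in hab; destruct hab as [w [<- ew]].
      apply hS in hbc; destruct hbc as [v [ev <-]].
      destruct (onto w v) as [x [<- <-]].
      { rewrite ew, ev; apply le_refl. }
      exists (umap e x); now split.
    + intros [y [<- <-]]; destruct (he y) as [x hx].
      change (umap e x = y) in hx; subst y.
      exists (umap q (umap l x)); rewrite kA, kC; split.
      * apply hR; now exists (umap l x).
      * apply (wrel_closed (a := umap s (umap r x)) (b := umap t (umap r x)));
          [apply sq| |apply le_refl].
        apply hS; now exists (umap r x).
Qed.

Lemma crel_order (A B : X) :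
  order (crel A B) (fun R S => forall a b, R a b -> S a b).
Proof.
  split.
  - intros R a b; trivial.
  - intros R S T h k a b r; now apply k, h.
  - intros R S h k; apply crel_eq; split; [apply h|apply k].
Qed.

Definition Rel : poscat.
Proof.
  refine (@PosCat X (fun A B => Poset (@crel_order A B))
    (fun A => CRel (id_is_crel A))
    (fun A B C S R => CRel (comp_is_crel (crel_tab S) (crel_tab R)))
    _ _ _ _).
  - intros A B C S S' R R' hS hR a c [b [r s]]; exists b; split.
    + now apply hR.
    + now apply hS.
  - intros A B R; apply crel_eq; intros a b; split.
    + intros [b' [r h]]; exact (wrel_closed (le_refl a) r h).
    + intros r; exists b; split; [exact r|apply le_refl].
  - intros A B R; apply crel_eq; intros a b; split.
    + intros [a' [h r]]; exact (wrel_closed h r (le_refl b)).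
    + intros r; exists a; split; [apply le_refl|exact r].
  - intros A B C D T S R; apply crel_eq; intros a d; split.
    + intros [c [[b [r s]] t]]; exists b; split; [exact r|]; now exists c.
    + intros [b [r [c [s t]]]]; exists c; split; [|exact t]; now exists b.
Defined.

Definition lower (A B : X) (f : hom A B) : @hom Rel A B := CRel (lower_is_crel f).

Definition upper (A B : X) (f : hom A B) : @hom Rel B A := CRel (upper_is_crel f).

Definition lower_functor : lmfunctor X (co Rel).
Proof.
  refine (@LMFunctor X (co Rel) (fun A => A) lower _ _ _).
  - intros A B f g fg a b h; simpl in *.
    exact (le_trans (fmap_mono (forget X) fg a) h).
  - intros A; apply crel_eq; intros a b; simpl; now rewrite umap_id.
  - intros A B C g f; apply crel_eq; intros a c; simpl; split.
    + rewrite umap_comp; intros h; exists (umap f a); split; [apply le_refl|exact h].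
    + rewrite umap_comp; intros [b [h k]]; exact (le_trans (mfun_mono (umap g) h) k).
Defined.

End Tabulation.

(** Right adjoints in [K] are unique, so quantifying over all right adjoints of
    [F f] amounts to speaking of "the" right adjoint of [F f]. In [rel_surj], "epi"
    means surjection: for an epi that is not surjective (the inclusion of the
    three-element chain into the four-element Boolean algebra, among distributive
    lattices) already [lower e ∘ upper e = idm] fails. *)
Record relational (X : order_regular) (K : poscat) (F : lmfunctor X (co K)) : Prop := {
  rel_adj : forall (A B : X) (f : hom A B), @has_right_adjoint K _ _ (fmap F f);
  rel_exact : forall (W X1 X2 Z : X)
      (p : hom W X1) (q : hom W X2) (f : hom X1 Z) (g : hom X2 Z),
    exact_square p q f g ->
    forall (pr : @hom K (F X1) (F W)) (gr : @hom K (F Z) (F X2)),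
      @right_adjoint K _ _ (fmap F p) pr ->
      @right_adjoint K _ _ (fmap F g) gr ->
      @comp K _ _ _ (fmap F q) pr = @comp K _ _ _ gr (fmap F f);
  rel_surj : forall (A B : X) (e : hom A B),
    surjection e ->
    forall er : @hom K (F B) (F A),
      @right_adjoint K _ _ (fmap F e) er ->
      @comp K _ _ _ (fmap F e) er = idm (F B)
}.

(* Main.v *)
From Stdlib Require Import List ProofIrrelevance FunctionalExtensionality.
From Stdlib Require Import IndefiniteDescription.
Require Import Defs.

Set Implicit Arguments.
Unset Strict Implicit.
Unset Printing Implicit Defensive.

(** If [(p, q)] tabulates [R], then [R = q_* · p^*], and functors preserve
    adjunctions, so an extension [H] of [F] must satisfy [H R = F q · (F p)^r].
    This formula is monotone in [R]: if every pair in the image of a span [(p, q)]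
    lies in the image of a span [(s, t)], the pullback of [<p, q>] and [<s, t>]
    has legs [l] and [r] with [l] surjective, [p l = s r] and [q l = t r], whence
    [F q (F p)^r = F(q l) F(p l)^r = F t F r (F r)^r (F s)^r <= F t (F s)^r].
    Hence it depends only on the relation and not on the span presenting it, and
    exactness of comma squares gives functoriality. *)

(** * Adjoints in poset-enriched categories and equality of functors *)

Lemma right_adjoint_unique (C : poscat) (A B : C) (f : hom A B) (r r' : hom B A) :
  right_adjoint f r -> right_adjoint f r' -> r = r'.
Proof.
  assert (aux : forall s s' : hom B A,
    right_adjoint f s -> right_adjoint f s' -> s ⊑ s').
  { intros s s' [_ hs] [hs' _].
    rewrite <- (comp_idl s).
    apply (le_trans (comp_mono hs' (le_refl s))).
    rewrite <- comp_assoc; rewrite <- (comp_idr s') at 2.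
    exact (comp_mono (le_refl s') hs). }
  intros h h'; apply le_antisym; now apply aux.
Qed.

Lemma right_adjoint_id (C : poscat) (A : C) : right_adjoint (idm A) (idm A).
Proof. split; rewrite comp_idl; apply le_refl. Qed.

Lemma right_adjoint_comp (C : poscat) (A B D : C) (g : hom B D) (f : hom A B)
    (gr : hom D B) (fr : hom B A) :
  right_adjoint g gr -> right_adjoint f fr -> right_adjoint (g ∘ f) (fr ∘ gr).
Proof.
  intros [g1 g2] [f1 f2]; split.
  - apply (le_trans f1).
    rewrite <- comp_assoc; apply comp_mono; [apply le_refl|].
    rewrite comp_assoc; rewrite <- (comp_idl f) at 1.
    now apply comp_mono; [|apply le_refl].
  - refine (le_trans _ g2).
    rewrite <- comp_assoc; apply comp_mono; [apply le_refl|].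
    rewrite comp_assoc; rewrite <- (comp_idl gr) at 2.
    now apply comp_mono; [|apply le_refl].
Qed.

(** Both functors share the object map [o], so their arrow parts have the same type and no transport
    along equalities of objects arises. *)
Lemma LMFunctor_eq (C D : poscat) (o : C -> D)
    (m m' : forall A B : C, hom A B -> hom (o A) (o B)) hm hm' hi hi' hc hc' :
  (forall A B f, m A B f = m' A B f) ->
  @LMFunctor C D o m hm hi hc = @LMFunctor C D o m' hm' hi' hc'.
Proof.
  intros e.
  assert (m = m').
  { apply functional_extensionality_dep; intros A.
    apply functional_extensionality_dep; intros B.
    apply functional_extensionality; intros f; apply e. }
  subst m'; f_equal; apply proof_irrelevance.
Qed.

Lemma LMFunctor_eta (C D : poscat) (F : lmfunctor C D) :
  LMFunctor (@fmap_mono _ _ F) (@fmap_id _ _ F) (@fmap_comp _ _ F) = F.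
Proof. now destruct F. Qed.

(** With singleton weights the limit of a cospan is its pullback: both legs to the apex must
    coincide, where [comma_weight] only asks for an inequality. *)
Definition pullback_weight : lmfunctor cospan Pos.
Proof.
  refine (@LMFunctor cospan Pos (fun _ => one)
            (fun _ _ _ => const_map one (tt : one)) _ _ _).
  - intros; intro; exact I.
  - intros; apply monotone_eq; intros []; reflexivity.
  - intros; apply monotone_eq; intros []; reflexivity.
Defined.

Lemma pullback_weight_finite : finite_weight pullback_weight.
Proof.
  split; [|split].
  - exists (cs_left :: cs_right :: cs_apex :: nil); intros []; simpl; tauto.
  - intros [] []; simpl; auto using finite_Prop_True, finite_Prop_False.
  - intros b; exists (tt :: nil); intros []; now left.
Qed.

(** * Relations presented by spans, and the properties (1) to (3) of [lower] *)

Section Spans.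
Variable X : order_regular.

Lemma umap_mono (A B : X) (f g : hom A B) (x : und A) :
  f ⊑ g -> umap f x ⊑ umap g x.
Proof. intros h; exact (fmap_mono (forget X) h x). Qed.

Lemma umap_reflect (A B : X) (f g : hom A B) :
  (forall x, umap f x ⊑ umap g x) -> f ⊑ g.
Proof. intros h; apply (@or_reflect X); exact h. Qed.

Lemma pullback_exists (A B Z : X) (f : hom A Z) (g : hom B Z) :
  exists (L : X) (l : hom L A) (r : hom L B),
    f ∘ l = g ∘ r /\
    (forall a b, umap f a = umap g b ->
       exists w : und L, umap l w = a /\ umap r w = b).
Proof.
  destruct (@or_limits X cospan pullback_weight (cospan_diagram f g)
              pullback_weight_finite) as (L & c & hc).
  pose proof (@or_preserve X cospan pullback_weight (cospan_diagram f g)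
                pullback_weight_finite L c hc one) as [_ onto].
  exists L, (@wleg _ _ _ _ _ c cs_left (tt : one)),
    (@wleg _ _ _ _ _ c cs_right (tt : one)).
  split.
  - pose proof (@wleg_nat _ _ _ _ _ c cs_left cs_apex I (tt : one)) as e1.
    pose proof (@wleg_nat _ _ _ _ _ c cs_right cs_apex I (tt : one)) as e2.
    simpl in e1, e2; now rewrite <- e1, <- e2.
  - intros a b ab.
    (* The pair [(a, b)] is a cone with vertex [one] over the underlying cospan; the preserved limit
       turns it into a point of [und L]. *)
    pose (d := @NatTrans cospan Pos pullback_weight
      (fcomp (hom_functor (one : Pos)) (fcomp (forget X) (cospan_diagram f g)))
      (fun j : cospan_ob =>
         match j return monotone one
           (@hom Pos one (forget X (cospan_diagram f g j))) with
         | cs_left => const_map one (const_map one a : @hom Pos one (und A))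
         | cs_right => const_map one (const_map one b : @hom Pos one (und B))
         | cs_apex => const_map one
             (const_map one (umap f a) : @hom Pos one (und Z))
         end)).
    destruct (onto (d ltac:(
      intros [] [] []; apply monotone_eq; intros []; apply monotone_eq; intros [];
      simpl; rewrite ?fmap_id; try reflexivity; exact ab))) as [h eh].
    exists (h tt); split.
    + exact (f_equal (fun m : monotone one _ => mfun m tt)
               (@wleg_eq _ _ _ _ _ _ _ eh cs_left (tt : one))).
    + exact (f_equal (fun m : monotone one _ => mfun m tt)
               (@wleg_eq _ _ _ _ _ _ _ eh cs_right (tt : one))).
Qed.

(** Unlike in [is_crelP], the legs need not be jointly order-reflecting, so composites can be
    presented by comma objects without taking images. *)
Definition spans (A B W : X) (p : hom W A) (q : hom W B) (R : @hom (Rel X) A B) :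
    Prop :=
  forall a b, (R : crel A B) a b <-> exists w : und W, umap p w = a /\ umap q w = b.

Lemma spans_exists (A B : X) (R : @hom (Rel X) A B) :
  exists (W : X) (p : hom W A) (q : hom W B), spans p q R.
Proof.
  destruct (proj1 (is_crelP _) (crel_tab R)) as (W & p & q & _ & h).
  now exists W, p, q.
Qed.

(** The composite is the weakening closure of the image of the span, and [R] is already closed. *)
Lemma spans_lower_upper (A B W : X) (p : hom W A) (q : hom W B)
    (R : @hom (Rel X) A B) :
  spans p q R -> R = lower q ∘ upper p.
Proof.
  intros h; apply crel_eq; intros a b; split.
  - intros r; apply h in r; destruct r as [w [<- <-]].
    exists w; split; apply le_refl.
  - intros [w [ha hb]].
    apply (wrel_closed ha (b := umap q w)); [|exact hb].
    apply h; now exists w.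
Qed.

Lemma comma_spans_exact (A B Z : X) (f : hom A Z) (g : hom B Z)
    (R : @hom (Rel X) A B) :
  (forall a b, (R : crel A B) a b <-> umap f a ⊑ umap g b) ->
  exists (W : X) (p : hom W A) (q : hom W B), spans p q R /\ exact_square p q f g.
Proof.
  intros hR; destruct (comma_exists f g) as (L & p & q & _ & sq & onto).
  exists L, p, q; split; [|split].
  - intros a b; rewrite hR; split; [apply onto|].
    intros [w [<- <-]]; apply sq.
  - apply umap_reflect; intros w; rewrite !umap_comp; apply sq.
  - intros a b h; destruct (onto _ _ h) as [w [<- <-]].
    exists w; split; apply le_refl.
Qed.

Lemma comp_spans_exact (A B C W V : X) (p : hom W A) (q : hom W B)
    (s : hom V B) (t : hom V C) (R : @hom (Rel X) A B) (S : @hom (Rel X) B C) :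
  spans p q R -> spans s t S ->
  exists (L : X) (l : hom L W) (r : hom L V),
    exact_square l r q s /\ spans (p ∘ l) (t ∘ r) (S ∘ R).
Proof.
  intros hR hS; destruct (comma_exists q s) as (L & l & r & _ & sq & onto).
  exists L, l, r; split; [split|].
  - apply umap_reflect; intros w; rewrite !umap_comp; apply sq.
  - intros w v h; destruct (onto _ _ h) as [x [<- <-]].
    exists x; split; apply le_refl.
  - intros a c; split.
    + intros [b [hab hbc]].
      apply hR in hab; destruct hab as [w [<- ew]].
      apply hS in hbc; destruct hbc as [v [ev <-]].
      destruct (onto w v) as [x [<- <-]].
      { rewrite ew, ev; apply le_refl. }
      exists x; now rewrite !umap_comp.
    + intros [x [<- <-]]; rewrite !umap_comp.
      exists (umap q (umap l x)); split.
      * apply hR; now exists (umap l x).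
      (* The comma square gives only [q l x ⊑ s r x]; closure of [S] under weakening absorbs this
         gap. *)
      * apply (wrel_closed (a := umap s (umap r x)) (b := umap t (umap r x)));
          [apply sq| |apply le_refl].
        apply hS; now exists (umap r x).
Qed.

Lemma lower_adjoint (A B : X) (f : hom A B) :
  right_adjoint (lower f) (upper f).
Proof.
  split.
  - intros a a' h; exists (umap f a); split; [apply le_refl|].
    exact (mfun_mono (umap f) h).
  - intros b b' [a [h h']]; exact (le_trans h h').
Qed.

Lemma lower_upper_exact (W X1 X2 Z : X)
    (p : hom W X1) (q : hom W X2) (f : hom X1 Z) (g : hom X2 Z) :
  exact_square p q f g -> lower q ∘ upper p = upper g ∘ lower f.
Proof.
  intros [sq onto]; apply crel_eq; intros x y; split.
  - intros [w [hx hy]]; exists (umap f (umap p w)); split.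
    + exact (mfun_mono (umap f) hx).
    + apply (le_trans (y := umap g (umap q w))).
      * rewrite <- !umap_comp; now apply umap_mono.
      * exact (mfun_mono (umap g) hy).
  - intros [z [hx hy]]; destruct (onto x y) as [w [h h']].
    { exact (le_trans hx hy). }
    now exists w.
Qed.

Lemma lower_upper_surjection (A B : X) (e : hom A B) :
  surjection e -> lower e ∘ upper e = idm (B : Rel X).
Proof.
  intros he; apply crel_eq; intros b b'; split.
  - intros [a [h h']]; exact (le_trans h h').
  - intros h; destruct (he b) as [a ea]; exists a.
    change (umap e a = b) in ea.
    split; simpl; rewrite ea; [apply le_refl|exact h].
Qed.

End Spans.

(** * Restriction of functors along [lower_functor] *)

Section Precomposition.
Variables (X : order_regular) (K : poscat) (H : lmfunctor (co (Rel X)) (co K)).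

(** The two order reversals cancel, so [H] is monotone from [Rel X] to [K] and carries the unit and
    counit of [lower_adjoint] along. *)
Lemma fmap_lower_adjoint (A B : X) (f : hom A B) :
  @right_adjoint K _ _ (fmap H (lower f)) (fmap H (upper f)).
Proof.
  destruct (lower_adjoint f) as [h1 h2]; split.
  - pose proof (@fmap_mono _ _ H A A _ _ h1) as k.
    rewrite (fmap_id H A : fmap H (idm (A : Rel X)) = _) in k.
    rewrite (fmap_comp H (upper f) (lower f) : fmap H (upper f ∘ lower f) = _) in k.
    exact k.
  - pose proof (@fmap_mono _ _ H B B _ _ h2) as k.
    rewrite (fmap_id H B : fmap H (idm (B : Rel X)) = _) in k.
    rewrite (fmap_comp H (lower f) (upper f) : fmap H (lower f ∘ upper f) = _) in k.
    exact k.
Qed.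

Lemma fcomp_lower_relational : relational (fcomp H (lower_functor X)).
Proof.
  split.
  - intros A B f; exists (fmap H (upper f)); apply fmap_lower_adjoint.
  - intros W X1 X2 Z p q f g sq pr gr hp hg.
    rewrite (right_adjoint_unique hp (fmap_lower_adjoint p)).
    rewrite (right_adjoint_unique hg (fmap_lower_adjoint g)).
    pose proof (f_equal (@fmap _ _ H X1 X2) (lower_upper_exact sq)) as k.
    etransitivity; [symmetry; exact (fmap_comp H (lower q) (upper p))|].
    etransitivity; [exact k|exact (fmap_comp H (upper g) (lower f))].
  - intros A B e he er her.
    rewrite (right_adjoint_unique her (fmap_lower_adjoint e)).
    pose proof (f_equal (@fmap _ _ H B B) (lower_upper_surjection he)) as k.
    etransitivity; [symmetry; exact (fmap_comp H (lower e) (upper e))|].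
    etransitivity; [exact k|exact (fmap_id H B)].
Qed.

End Precomposition.

(** * Extension of a relational functor to all relations *)

Section Extension.
Variables (X : order_regular) (K : poscat) (F : lmfunctor X (co K)).
Hypothesis hF : relational F.

(** [fmap F] with values in [K] instead of [co K], so that composites are taken
    in [K]. *)
Definition arr (A B : X) (f : hom A B) : @hom K (F A) (F B) := fmap F f.

Lemma arr_id (A : X) : arr (idm A) = idm (F A : K).
Proof. exact (fmap_id F A). Qed.

Lemma arr_comp (A B C : X) (g : hom B C) (f : hom A B) :
  arr (g ∘ f) = arr g ∘ arr f.
Proof. exact (fmap_comp F g f). Qed.

(** A predicate rather than a function, because right adjoints are only known to exist; choice is
    deferred to [extend]. *)
Definition span_value (A B W : X) (p : hom W A) (q : hom W B)
    (h : @hom K (F A) (F B)) : Prop :=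
  exists pr : @hom K (F A) (F W), right_adjoint (arr p) pr /\ h = arr q ∘ pr.

Lemma span_value_exists (A B W : X) (p : hom W A) (q : hom W B) :
  exists h, span_value p q h.
Proof.
  destruct (rel_adj hF p) as [pr hp]; exists (arr q ∘ pr); now exists pr.
Qed.

Lemma span_value_exact (W A B Z : X) (p : hom W A) (q : hom W B)
    (f : hom A Z) (g : hom B Z) h gr :
  exact_square p q f g -> right_adjoint (arr g) gr -> span_value p q h ->
  h = gr ∘ arr f.
Proof.
  intros sq hg (pr & hp & ->); exact (rel_exact hF sq hp hg).
Qed.

Lemma span_value_le (A B W V : X) (p : hom W A) (q : hom W B)
    (s : hom V A) (t : hom V B) h k :
  (forall w : und W, exists v : und V, umap s v = umap p w /\ umap t v = umap q w) ->
  span_value p q h -> span_value s t k -> h ⊑ k.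
Proof.
  intros sub (pr & hp & ->) (sr & hs & ->).
  destruct (product_exists A B) as (P & pA & pB & embP & pairing).
  destruct (pairing W p q) as (m & mA & mB).
  destruct (pairing V s t) as (n & nA & nB).
  destruct (pullback_exists m n) as (L & l & r & sq & onto).
  assert (esp : p ∘ l = s ∘ r)
    by now rewrite <- mA, <- nA, <- !comp_assoc, sq.
  assert (etq : q ∘ l = t ∘ r)
    by now rewrite <- mB, <- nB, <- !comp_assoc, sq.
  (* Over [w], [sub] yields [v] with the same coordinates; since [pA] and [pB] jointly reflect the
     order, [m w = n v], and the pullback has a point above this pair. *)
  assert (surj : surjection l).
  { intros w; destruct (sub w) as [v [ev ev']].
    destruct (onto w v) as [x [ex _]]; [|now exists x].
    apply le_antisym; apply embP;
      rewrite <- !umap_comp, ?mA, ?mB, ?nA, ?nB, ?ev, ?ev'; apply le_refl. }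
  destruct (rel_adj hF l) as [lr hl], (rel_adj hF r) as [rr hr].
  change (right_adjoint (arr l) lr) in hl.
  change (right_adjoint (arr r) rr) in hr.
  assert (el : arr l ∘ lr = idm (F W : K)) by exact (rel_surj hF surj hl).
  (* [lr ∘ pr] and [rr ∘ sr] are both right adjoint to the image of [p ∘ l = s ∘ r], hence equal. *)
  pose proof (right_adjoint_comp hp hl) as hpl.
  pose proof (right_adjoint_comp hs hr) as hsr.
  rewrite <- arr_comp in hpl, hsr; rewrite esp in hpl.
  pose proof (right_adjoint_unique hpl hsr) as er.
  rewrite <- (comp_idl pr), <- el, <- comp_assoc, er.
  rewrite !comp_assoc, <- arr_comp, etq, arr_comp.
  apply comp_mono; [|apply le_refl].
  rewrite <- comp_assoc; rewrite <- (comp_idr (arr t)) at 2.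
  apply comp_mono; [apply le_refl|exact (proj2 hr)].
Qed.

Definition value (A B : X) (R : @hom (Rel X) A B) (h : @hom K (F A) (F B)) : Prop :=
  exists (W : X) (p : hom W A) (q : hom W B), spans p q R /\ span_value p q h.

Lemma value_exists (A B : X) (R : @hom (Rel X) A B) : exists h, value R h.
Proof.
  destruct (spans_exists R) as (W & p & q & hR).
  destruct (span_value_exists p q) as [h hh].
  now exists h, W, p, q.
Qed.

Lemma value_mono (A B : X) (R S : @hom (Rel X) A B) h k :
  R ⊑ S -> value R h -> value S k -> h ⊑ k.
Proof.
  intros RS (W & p & q & hR & hh) (V & s & t & hS & hk).
  refine (span_value_le _ hh hk).
  intros w; apply hS, RS, hR; now exists w.
Qed.

Lemma value_unique (A B : X) (R : @hom (Rel X) A B) h k :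
  value R h -> value R k -> h = k.
Proof. intros hh hk; apply le_antisym; eapply value_mono; eauto using le_refl. Qed.

(** The graph of [lower f] is the comma object of [f] and the identity; exactness of that square
    reduces its value to [arr f], the identity being its own adjoint. *)
Lemma value_lower (A B : X) (f : hom A B) : value (lower f) (arr f).
Proof.
  destruct (@comma_spans_exact X A B B f (idm B) (lower f))
    as (W & p & q & hR & sq).
  { intros a b; rewrite umap_id; reflexivity. }
  destruct (span_value_exists p q) as [h hh].
  exists W, p, q; split; [exact hR|].
  pose proof (right_adjoint_id (F B : K)) as hi; rewrite <- arr_id in hi at 1.
  pose proof (span_value_exact sq hi hh) as e.
  rewrite comp_idl in e; now rewrite <- e.
Qed.

(** Exactness of the comma square of [q] and [s] replaces the inner factor [sr ∘ arr q] by
    [arr r ∘ lr], which leaves the value of the composite span. *)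
Lemma value_comp (A B C : X) (S : @hom (Rel X) B C) (R : @hom (Rel X) A B) h k :
  value R h -> value S k -> value (S ∘ R) (k ∘ h).
Proof.
  intros (W & p & q & hR & pr & hp & ->) (V & s & t & hS & sr & hs & ->).
  destruct (comp_spans_exact hR hS) as (L & l & r & sq & hSR).
  exists L, (p ∘ l), (t ∘ r); split; [exact hSR|].
  destruct (rel_adj hF l) as [lr hl]; change (right_adjoint (arr l) lr) in hl.
  exists (lr ∘ pr); split.
  - rewrite arr_comp; now apply right_adjoint_comp.
  - assert (e : arr r ∘ lr = sr ∘ arr q) by exact (rel_exact hF sq hl hs).
    rewrite arr_comp, <- !comp_assoc; f_equal.
    now rewrite !comp_assoc, e.
Qed.

Definition extend (A B : X) (R : @hom (Rel X) A B) : @hom K (F A) (F B) :=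
  proj1_sig (constructive_indefinite_description _ (value_exists R)).

Lemma extend_value (A B : X) (R : @hom (Rel X) A B) : value R (extend R).
Proof. exact (proj2_sig (constructive_indefinite_description _ (value_exists R))). Qed.

Lemma extend_lower (A B : X) (f : hom A B) : extend (lower f) = arr f.
Proof. exact (value_unique (extend_value _) (value_lower f)). Qed.

Definition extension : lmfunctor (co (Rel X)) (co K).
Proof.
  refine (@LMFunctor (co (Rel X)) (co K) (fob F) extend _ _ _).
  (* In the [co] categories [h] says that [S] is contained in [R], hence the swapped arguments. *)
  - intros A B R S h; exact (value_mono h (extend_value S) (extend_value R)).
  - intros A.
    etransitivity; [|exact (arr_id A)].
    (* The identity relation is [lower (idm A)]. *)
    rewrite <- extend_lower; f_equal; symmetry.
    exact (fmap_id (lower_functor X) A).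
  - intros A B C S R.
    exact (value_unique (extend_value _)
             (value_comp (extend_value R) (extend_value S))).
Defined.

Lemma fcomp_extension : fcomp extension (lower_functor X) = F.
Proof.
  etransitivity; [|apply LMFunctor_eta].
  apply LMFunctor_eq; exact extend_lower.
Qed.

End Extension.

(** [H R] is itself a value of [R]: write [R] as [lower q ∘ upper p] and use that [H] sends
    [upper p] to the adjoint of the image of [p]. Extending the restriction of [H] itself keeps the
    object maps identical. *)
Lemma extension_unique (X : order_regular) (K : poscat)
    (H : lmfunctor (co (Rel X)) (co K))
    (hF : relational (fcomp H (lower_functor X))) :
  extension hF = H.
Proof.
  etransitivity; [|apply LMFunctor_eta].
  apply LMFunctor_eq; intros A B R.
  apply (value_unique hF (extend_value hF R)).
  destruct (spans_exists R) as (W & p & q & hR).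
  exists W, p, q; split; [exact hR|].
  exists (fmap H (upper p)); split; [apply fmap_lower_adjoint|].
  rewrite (spans_lower_upper hR).
  exact (fmap_comp H (lower q) (upper p)).
Qed.

Theorem theorem6p11 (X : order_regular) :
  (forall (A B : X) (f : hom A B), has_right_adjoint (lower f)) /\
  (forall (W X1 X2 Z : X)
      (p : hom W X1) (q : hom W X2) (f : hom X1 Z) (g : hom X2 Z),
    exact_square p q f g -> lower q ∘ upper p = upper g ∘ lower f) /\
  (forall (A B : X) (e : hom A B),
    surjection e -> lower e ∘ upper e = idm (B : Rel X)) /\
  (forall K : order_regular,
    (forall H : lmfunctor (co (Rel X)) (co K),
      relational (fcomp H (lower_functor X))) /\
    (forall F : lmfunctor X (co K), relational F ->
      exists! H : lmfunctor (co (Rel X)) (co K),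
        fcomp H (lower_functor X) = F)).
Proof.
  split; [|split; [|split]].
  - intros A B f; exists (upper f); apply lower_adjoint.
  - intros; now apply lower_upper_exact.
  - intros; now apply lower_upper_surjection.
  - intros K; split; [intros H; apply fcomp_lower_relational|].
    intros F hF; exists (extension hF); split; [apply fcomp_extension|].
    intros H <-; apply extension_unique.
Qed.
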